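(* Let $\mathfrak g$ and $\mathfrak g_0$ be real $3$-dimensional Lie algebras such that $\mathfrak g_0$ is a continuous contraction of $\mathfrak g$. Then there exist constant matrices $P,Q\in GL_3(\mathbb R)$ and nonnegative integers $\alpha_1,\alpha_2,\alpha_3$ such that $U_\varepsilon=P\,\mathrm{diag}(\varepsilon^{\alpha_1},\varepsilon^{\alpha_2},\varepsilon^{\alpha_3})\,Q$ is a contraction matrix contracting $\mathfrak g$ to a Lie algebra isomorphic to $\mathfrak g_0$. Moreover, unless $\mathfrak g\cong so(3)$ and $\mathfrak g_0\cong\mathfrak h_3$, the exponents can be chosen with $\alpha_1,\alpha_2,\alpha_3\in\{0,1\}$ (a simple In\''on\''u--Wigner contraction); whereas for $\mathfrak g\cong so(3)$, $\mathfrak g_0\cong\mathfrak h_3$ no matrix of this form with all $\alpha_i\in\{0,1\}$ contracts $\mathfrak g$ to an algebra isomorphic to $\mathfrak g_0$.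
   Context: Continuous contraction: for an $n$-dimensional Lie algebra $\mathfrak g=(V,[\cdot,\cdot])$ and a continuous map $U:(0,1]\to GL(V)$, put $[x,y]_\varepsilon=U_\varepsilon^{-1}[U_\varepsilon x,U_\varepsilon y]$; if $[x,y]_0=\lim_{\varepsilon\to0^+}[x,y]_\varepsilon$ exists for all $x,y$, then $(V,[\cdot,\cdot]_0)$ is a contraction of $\mathfrak g$ and $U$ its contraction matrix (matrices taken in a fixed basis). $so(3)$ has basis with $[e_1,e_2]=e_3$, $[e_2,e_3]=e_1$, $[e_3,e_1]=e_2$; $\mathfrak h_3$ is the Heisenberg algebra with only nonzero bracket $[e_2,e_3]=e_1$. *)

(* Defs.v *)
From mathcomp Require Import all_boot all_order all_algebra.
From mathcomp Require Import all_classical all_reals all_analysis.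
Set Implicit Arguments. Unset Strict Implicit. Unset Printing Implicit Defensive.
Import Order.TTheory GRing.Theory Num.Theory.
Import numFieldNormedType.Exports.
Local Open Scope classical_set_scope.
Local Open Scope ring_scope.

Section Defs.
Variable R : realType.

Definition bracket := 'cV[R]_3 -> 'cV[R]_3 -> 'cV[R]_3.

Definition is_lie (br : bracket) : Prop :=
  [/\ (forall (a : R) x y z, br (a *: x + y) z = a *: br x z + br y z),
      (forall (a : R) x y z, br x (a *: y + z) = a *: br x y + br x z),
      (forall x, br x x = 0) &
      (forall x y z, br x (br y z) + br y (br z x) + br z (br x y) = 0)].

Definition lie_iso (br1 br2 : bracket) : Prop :=
  exists A : 'M[R]_3, A \in unitmx /\
    forall x y, A *m br1 x y = br2 (A *m x) (A *m y).

Definition conj_bracket (br : bracket) (M : 'M[R]_3) : bracket :=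
  fun x y => invmx M *m br (M *m x) (M *m y).

(* U : (0,1] -> GL(V) continuous, and [x,y]_eps --> br0 x y as eps -> 0+.
   (U is given as a function on R; only its values on (0,1] matter.) *)
Definition contracts_via (br : bracket) (U : R -> 'M[R]_3) (br0 : bracket) : Prop :=
  [/\ (forall e : R, 0 < e <= 1 -> U e \in unitmx),
      {within `]0, 1], continuous U} &
      (forall x y, conj_bracket br (U e) x y @[e --> 0^'+] --> br0 x y)].

Definition is_lie_contraction (br br0 : bracket) : Prop :=
  exists U : R -> 'M[R]_3, contracts_via br U br0.

Definition diag_contraction_matrix (P Q : 'M[R]_3) (alpha : 'I_3 -> nat) :
  R -> 'M[R]_3 :=
  fun e => P *m diag_mx (\row_i (e ^+ alpha i)) *m Q.

Definition diag_contracts (br br0 : bracket) (P Q : 'M[R]_3)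
  (alpha : 'I_3 -> nat) : Prop :=
  exists br1 : bracket,
    contracts_via br (diag_contraction_matrix P Q alpha) br1 /\ lie_iso br1 br0.

Definition coord (x : 'cV[R]_3) (k : nat) : R := x (inord k) 0.

(* so(3): [e1,e2]=e3, [e2,e3]=e1, [e3,e1]=e2 (basis e1,e2,e3 = coordinates 0,1,2) *)
Definition so3 : bracket := fun x y =>
  \col_(k < 3)
    (if val k == 0%N then coord x 1 * coord y 2 - coord x 2 * coord y 1
     else if val k == 1%N then coord x 2 * coord y 0 - coord x 0 * coord y 2
     else coord x 0 * coord y 1 - coord x 1 * coord y 0).

(* Heisenberg h3: only nonzero bracket [e2,e3]=e1 *)
Definition h3 : bracket := fun x y =>
  \col_(k < 3)
    (if val k == 0%N then coord x 1 * coord y 2 - coord x 2 * coord y 1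
     else 0).

End Defs.

(* Main.v *)
(** A bracket on R^3 is x, y |-> M (x × y) for a unique structure matrix M, and
a change of basis U turns M into det(U) U^-1 M U^-T.  Writing M as a symmetric
part S plus the cross-product matrix of a vector a, the Jacobi identity says
S a = 0, so diagonalising S by congruence gives a short list of normal forms.
A contraction puts the limit in the closure of the orbit of M.  Symmetry and
antisymmetry of M, the vanishing of det M, linear relations between the Killing
form K(x, x) and (tr ad x)^2, semidefiniteness of K and the reverse
Cauchy-Schwarz inequality for K are all invariant closed conditions, and they
exclude every pair of normal forms that is not linked by some diag(e^alpha).
Under diag(e^alpha) the entry M_ij is multiplied by
e^(alpha_1 + alpha_2 + alpha_3 - alpha_i - alpha_j), so the limit exists exactly
when M_ij = 0 at the negative exponents, and it keeps the entries of exponent 0.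
For so(3) the form S is definite, so with exponents in {0, 1} the limit either
vanishes or keeps a nonzero 2x2 minor, whereas the structure matrix of the
Heisenberg algebra has rank one; the exponents (2, 1, 1) do reach it. *)
Require Import Defs.
From mathcomp Require Import all_boot all_order all_algebra.
From mathcomp Require Import all_classical all_reals all_analysis.
From mathcomp Require Import ring lra zify.
Import Order.TTheory GRing.Theory Num.Theory.
Import numFieldNormedType.Exports.
Local Open Scope ring_scope.
Set Implicit Arguments.
Unset Strict Implicit.
Unset Printing Implicit Defensive.

Local Notation i0 := (inord 0 : 'I_3).
Local Notation i1 := (inord 1 : 'I_3).
Local Notation i2 := (inord 2 : 'I_3).

(** * 3x3 matrices *)

Lemma ord3P (P : 'I_3 -> Prop) : P i0 -> P i1 -> P i2 -> forall i, P i.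
Proof.
move=> P0 P1 P2 [[|[|[|//]]] lti].
- by rewrite (_ : Ordinal lti = i0) //; apply/val_inj; rewrite /= inordK.
- by rewrite (_ : Ordinal lti = i1) //; apply/val_inj; rewrite /= inordK.
- by rewrite (_ : Ordinal lti = i2) //; apply/val_inj; rewrite /= inordK.
Qed.

Lemma sum_ord3 (V : nmodType) (F : 'I_3 -> V) :
  \sum_i F i = F i0 + F i1 + F i2.
Proof.
rewrite !big_ord_recr big_ord0 /= add0r.
by congr (F _ + F _ + F _); apply/val_inj; rewrite /= inordK.
Qed.

Lemma inord3K : ((i0 : nat) = 0%N) * ((i1 : nat) = 1%N) * ((i2 : nat) = 2%N).
Proof. by rewrite !inordK. Qed.

Lemma ord3_neq :
  ((i0 == i1) = false) * ((i0 == i2) = false) * ((i1 == i0) = false) *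
  ((i1 == i2) = false) * ((i2 == i0) = false) * ((i2 == i1) = false).
Proof. by rewrite -!val_eqE /= !inord3K. Qed.

Section Matrix3.
Variable R : comNzRingType.

(** Nine explicit scalars turn a matrix identity into nine scalar equations that [ring] or [field]
    can settle. *)
Definition mx3 (a b c d e f g h k : R) : 'M[R]_3 := \matrix_(i, j)
  nth 0 (nth [::] [:: [:: a; b; c]; [:: d; e; f]; [:: g; h; k]] i) j.

Lemma mx3E a b c d e f g h k (M := mx3 a b c d e f g h k) :
  ((M i0 i0 = a) * (M i0 i1 = b) * (M i0 i2 = c)) *
  ((M i1 i0 = d) * (M i1 i1 = e) * (M i1 i2 = f)) *
  ((M i2 i0 = g) * (M i2 i1 = h) * (M i2 i2 = k)).
Proof. by rewrite /M !mxE !inord3K. Qed.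

Lemma mx3P (M : 'M[R]_3) : M = mx3 (M i0 i0) (M i0 i1) (M i0 i2)
  (M i1 i0) (M i1 i1) (M i1 i2) (M i2 i0) (M i2 i1) (M i2 i2).
Proof. by apply/matrixP; elim/ord3P; elim/ord3P; rewrite mx3E. Qed.

Lemma mul_mx3 a b c d e f g h k a' b' c' d' e' f' g' h' k' :
  mx3 a b c d e f g h k *m mx3 a' b' c' d' e' f' g' h' k' =
  mx3 (a * a' + b * d' + c * g') (a * b' + b * e' + c * h')
        (a * c' + b * f' + c * k')
      (d * a' + e * d' + f * g') (d * b' + e * e' + f * h')
        (d * c' + e * f' + f * k')
      (g * a' + h * d' + k * g') (g * b' + h * e' + k * h')
        (g * c' + h * f' + k * k').
Proof.
by apply/matrixP; elim/ord3P; elim/ord3P; rewrite mx3E mxE sum_ord3 !mx3E.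
Qed.

Lemma tr_mx3 a b c d e f g h k :
  (mx3 a b c d e f g h k)^T = mx3 a d g b e h c f k.
Proof. by apply/matrixP; elim/ord3P; elim/ord3P; rewrite mxE !mx3E. Qed.

Lemma scale_mx3 z a b c d e f g h k : z *: mx3 a b c d e f g h k =
  mx3 (z * a) (z * b) (z * c) (z * d) (z * e) (z * f) (z * g) (z * h) (z * k).
Proof. by apply/matrixP; elim/ord3P; elim/ord3P; rewrite mxE !mx3E. Qed.

Lemma det_mx3 a b c d e f g h k : \det (mx3 a b c d e f g h k) =
  a * (e * k - f * h) - b * (d * k - f * g) + c * (d * h - e * g).
Proof.
rewrite (expand_det_row _ i0) sum_ord3 !mx3E /cofactor !inord3K.
rewrite !(expand_det_row _ ord0) !big_ord_recl !big_ord0 /= /cofactor !det_mx11.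
rewrite !mxE /= !inord3K /= /bump /=; ring.
Qed.
End Matrix3.

(** * Brackets and structure matrices *)

Lemma mulmx_cV_inj (R : pzRingType) m n (A B : 'M[R]_(m, n)) :
  (forall v : 'cV_n, A *m v = B *m v) -> A = B.
Proof.
move=> eqAB; apply/matrixP => i j.
by have /matrixP/(_ i 0) := eqAB (delta_mx j 0); rewrite -!colE !mxE.
Qed.

Lemma delta_mx_form (R : pzRingType) n (A : 'M[R]_n) k l :
  (delta_mx (0 : 'I_1) k *m A *m (delta_mx (0 : 'I_1) l)^T) 0 0 = A k l.
Proof. by rewrite trmx_delta -rowE -[_ *m delta_mx l 0]colE !mxE. Qed.

Section StructureMatrix.
Variable R : realType.
Implicit Types (M N U V W : 'M[R]_3) (x y : 'cV[R]_3).

Definition brM M : bracket R := fun x y => M *m so3 x y.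

Lemma so3E x y :
  (so3 x y i0 0 = x i1 0 * y i2 0 - x i2 0 * y i1 0) *
  (so3 x y i1 0 = x i2 0 * y i0 0 - x i0 0 * y i2 0) *
  (so3 x y i2 0 = x i0 0 * y i1 0 - x i1 0 * y i0 0).
Proof. by rewrite /so3 !mxE /= !inord3K. Qed.

Definition cross_mx x : 'M[R]_3 := mx3 0 (- x i2 0) (x i1 0)
  (x i2 0) 0 (- x i0 0) (- x i1 0) (x i0 0) 0.

Lemma cross_mxE x y : cross_mx x *m y = so3 x y.
Proof.
apply/matrixP; elim/ord3P => j; rewrite ord1 mxE sum_ord3 !mx3E so3E; ring.
Qed.

Lemma so3_delta :
  (so3 (delta_mx i1 0) (delta_mx i2 0) = delta_mx i0 0 :> 'cV[R]_3) *
  (so3 (delta_mx i2 0) (delta_mx i0 0) = delta_mx i1 0 :> 'cV[R]_3) *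
  (so3 (delta_mx i0 0) (delta_mx i1 0) = delta_mx i2 0 :> 'cV[R]_3).
Proof.
by split; first split; apply/matrixP; elim/ord3P => k;
  rewrite ord1 so3E !mxE !eqxx !ord3_neq /=; ring.
Qed.

(** Since cross products reach every basis vector, a bracket determines each column of its structure
    matrix. *)
Lemma so3_span (j : 'I_3) : exists x y, so3 x y = delta_mx j 0.
Proof.
by elim/ord3P: j; do 2 eexists; [apply: so3_delta.1.1 | apply: so3_delta.1.2
  | apply: so3_delta.2].
Qed.

Lemma so3_ext M N : (forall x y, M *m so3 x y = N *m so3 x y) -> M = N.
Proof.
move=> eqMN; apply/matrixP => i j; have [x [y xyj]] := so3_span j.
by have /matrixP/(_ i 0) := eqMN x y; rewrite xyj -!colE !mxE.
Qed.

(** Paired with a vector [z], this is the multiplicativity of the determinant of the triple (z, x,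
    y). It is the source of the transformation law of structure matrices. *)
Lemma so3_mul U x y :
  U^T *m so3 (U *m x) (U *m y) = \det U *: so3 x y.
Proof.
rewrite {4}[U]mx3P det_mx3; apply/matrixP; elim/ord3P => j; rewrite ord1;
  rewrite mxE sum_ord3 [RHS]mxE !so3E !mxE !sum_ord3; ring.
Qed.

Lemma cross_mx_mul U x : U^T *m cross_mx (U *m x) *m U = \det U *: cross_mx x.
Proof.
by apply: mulmx_cV_inj => y; rewrite -scalemxAl -!mulmxA !cross_mxE so3_mul.
Qed.

(* N = det(U) U^-1 M U^-T, that is, brM N is brM M in the basis U. *)
Definition eqv M N :=
  exists2 U, U \in unitmx & U *m N *m U^T = \det U *: M.

Definition act_mx U M := \det U *: (invmx U *m M *m (invmx U)^T).

Lemma act_mxE U M : U \in unitmx ->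
  U *m act_mx U M *m U^T = \det U *: M.
Proof.
move=> Uu; rewrite -scalemxAr -scalemxAl; congr (_ *: _).
by rewrite -!mulmxA mulKVmx // trmx_inv mulVmx ?unitmx_tr // mulmx1.
Qed.

Lemma conj_brM M N U : U \in unitmx -> U *m N *m U^T = \det U *: M ->
  conj_bracket (brM M) U = brM N.
Proof.
move=> Uu eqU; apply/funext => x; apply/funext => y; rewrite /conj_bracket.
have dU : \det U != 0 by rewrite -unitfE -unitmxE.
apply: (can_inj (mulKmx Uu)); rewrite mulKVmx // /brM.
apply: (scalerI dU); rewrite scalemxAl -eqU -!mulmxA so3_mul.
by rewrite -!scalemxAr.
Qed.

Lemma conj_brM_eq M N U : U \in unitmx ->
  conj_bracket (brM M) U = brM N -> U *m N *m U^T = \det U *: M.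
Proof.
move=> Uu eqU; have UTu : U^T \in unitmx by rewrite unitmx_tr.
suff -> : N = act_mx U M by exact: act_mxE.
apply: so3_ext => x y; have := congr1 (fun b => b x y) eqU.
rewrite /conj_bracket {2}/brM => <-; rewrite /act_mx -scalemxAl -!mulmxA.
by rewrite !scalemxAr -so3_mul trmx_inv mulKmx.
Qed.

Lemma eqv_act_mx U M : U \in unitmx -> eqv M (act_mx U M).
Proof. by move=> Uu; exists U => //; apply: act_mxE. Qed.

Lemma eqv_refl M : eqv M M.
Proof.
by exists 1%:M; rewrite ?unitmx1 // trmx1 mulmx1 mul1mx det1 scale1r.
Qed.

Lemma eqv_sym M N : eqv M N -> eqv N M.
Proof.
move=> [U Uu eqU]; exists (invmx U); first by rewrite unitmx_inv.
have dU : \det U != 0 by rewrite -unitfE -unitmxE.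
rewrite det_inv; apply: (scalerI dU); rewrite scalerA divff // scale1r.
rewrite scalemxAl scalemxAr -eqU -!mulmxA trmx_inv mulmxV ?unitmx_tr // mulmx1.
by rewrite mulKmx.
Qed.

Lemma eqv_trans N M K : eqv M N -> eqv N K -> eqv M K.
Proof.
move=> [U Uu eqU] [V Vu eqV]; exists (U *m V); first by rewrite unitmx_mul Uu.
rewrite trmx_mul !mulmxA -[U *m V *m K]mulmxA -[U *m _ *m _]mulmxA eqV.
by rewrite -scalemxAr -scalemxAl eqU scalerA mulrC det_mulmx.
Qed.

Lemma eqv_lie_iso M N : eqv M N <-> lie_iso (brM N) (brM M).
Proof.
split=> [[U Uu eqU]|[U [Uu eqU]]]; exists U => //.
  split=> // x y; rewrite -(conj_brM Uu eqU).
  by rewrite /conj_bracket mulKVmx.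
apply: conj_brM_eq => //; apply/funext => x; apply/funext => y.
by rewrite /conj_bracket -eqU mulKmx.
Qed.

Lemma so3_brM : @so3 R = brM 1%:M.
Proof. by apply/funext => x; apply/funext => y; rewrite /brM mul1mx. Qed.

Definition diag3 (a b c : R) := mx3 a 0 0 0 b 0 0 0 c.

Lemma diag3_1 : diag3 1 1 1 = 1%:M.
Proof.
by rewrite [1%:M]mx3P !mxE -!val_eqE /= !inord3K.
Qed.

Lemma h3_brM : @h3 R = brM (diag3 1 0 0).
Proof.
apply/funext => x; apply/funext => y; rewrite /brM /diag3; apply/matrixP.
elim/ord3P => j;
  rewrite ord1 [LHS]mxE [RHS]mxE sum_ord3 !mx3E !so3E /= !inord3K /Defs.coord;
  rewrite /=; ring.
Qed.

(* M - M^T = cross_mx (axial M). *)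
Definition axial M : 'cV[R]_3 := \col_i
  nth 0 [:: M i2 i1 - M i1 i2; M i0 i2 - M i2 i0; M i1 i0 - M i0 i1] i.

Lemma axialE M : (axial M i0 0 = M i2 i1 - M i1 i2) *
  (axial M i1 0 = M i0 i2 - M i2 i0) * (axial M i2 0 = M i1 i0 - M i0 i1).
Proof. by rewrite /axial !mxE !inord3K. Qed.

Lemma is_lie_conj br U : U \in unitmx ->
  is_lie br -> is_lie (conj_bracket br U).
Proof.
move=> Uu [brl brr br0 brJ]; rewrite /conj_bracket.
split=> [a x y z|a x y z|x|x y z].
- by rewrite mulmxDr -scalemxAr brl mulmxDr -scalemxAr.
- by rewrite mulmxDr -scalemxAr brr mulmxDr -scalemxAr.
- by rewrite br0 mulmx0.
- by rewrite !mulKVmx // -!mulmxDr brJ mulmx0.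
Qed.

Lemma is_lie_brM br : is_lie br -> exists M, br = brM M.
Proof.
move=> [brl brr br0 _].
pose e0 : 'cV[R]_3 := delta_mx i0 0; pose e1 : 'cV[R]_3 := delta_mx i1 0.
pose e2 : 'cV[R]_3 := delta_mx i2 0.
have brD x y z : br (x + y) z = br x z + br y z.
  by have := brl 1 x y z; rewrite !scale1r.
have brDr x y z : br x (y + z) = br x y + br x z.
  by have := brr 1 x y z; rewrite !scale1r.
have br0l z : br 0 z = 0 by apply: (addIr (br 0 z)); rewrite -brD !add0r.
have br0r z : br z 0 = 0 by apply: (addIr (br z 0)); rewrite -brDr !add0r.
have brZ a x z : br (a *: x) z = a *: br x z.
  by have := brl a x 0 z; rewrite br0l !addr0.
have brZr a x z : br z (a *: x) = a *: br z x.
  by have := brr a z x 0; rewrite br0r !addr0.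
have brC x y : br y x = - br x y.
  apply/eqP; rewrite -addr_eq0 addrC.
  by have := br0 (x + y); rewrite brD !brDr !br0 add0r addr0 => ->.
have dec (x : 'cV[R]_3) : x = x i0 0 *: e0 + x i1 0 *: e1 + x i2 0 *: e2.
  rewrite [LHS]matrix_sum_delta sum_ord3.
  by rewrite !big_ord_recl !big_ord0 !addr0.
(* The columns are the brackets of the cyclic basis pairs, because [so3] sends these pairs to the
   basis vectors. *)
exists (\matrix_(i, j) nth 0 [:: br e1 e2 i 0; br e2 e0 i 0; br e0 e1 i 0] j).
apply/funext => x; apply/funext => y; rewrite [in LHS](dec x) [in LHS](dec y).
rewrite !(brD, brDr, brZ, brZr, br0) (brC e0 e1) (brC e1 e2) (brC e2 e0).
apply/matrixP => i j.
rewrite ord1 [RHS]mxE sum_ord3 !so3E !mxE !inord3K /=; ring.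
Qed.

(** On the standard basis the Jacobi sum is [M] applied to the sum of the vectors e_i × M e_i, and
    that sum is [axial M]. *)
Lemma jacobi_axial M : is_lie (brM M) -> M *m axial M = 0.
Proof.
move=> [_ _ _ J].
rewrite -(J (delta_mx i0 0) (delta_mx i1 0) (delta_mx i2 0)) /brM !so3_delta.
rewrite -!mulmxDr -!colE; congr (_ *m _); apply/matrixP.
elim/ord3P => j; rewrite ord1 axialE [RHS]mxE [X in _ = X + _]mxE !so3E;
  rewrite !mxE !eqxx !ord3_neq /=; ring.
Qed.

End StructureMatrix.

(** * Diagonalisation of quadratic forms by congruence *)

Section Congruence.
Variable F : fieldType.
Hypothesis char2 : (2 : F) != 0.

(** By polarisation a nonzero symmetric form takes a nonzero value at some vector, and completing
    this vector to a basis puts a nonzero multiple of the value in the corner. *)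
Lemma congr_anisotropic n (S : 'M[F]_n.+1) : S^T = S -> S != 0 ->
  exists2 W, W \in unitmx & (W *m S *m W^T) ord0 ord0 != 0.
Proof.
move=> symS S0.
have entry (v : 'rV[F]_n.+1) : (v *m S *m v^T) 0 0 != 0 ->
    exists2 W, W \in unitmx & (W *m S *m W^T) ord0 ord0 != 0.
  move=> qv; have v0 : v != 0.
    by apply: contraNneq qv => ->; rewrite !mul0mx mxE.
  exists (row_ebase v); first exact: row_ebase_unit.
  (* The rank factorisation of a nonzero row exhibits it as a multiple of the first row of the
     invertible matrix [row_ebase v]. *)
  have [c vE] : exists c, v = c *: row ord0 (row_ebase v).
    exists (col_ebase v 0 0); rewrite -[LHS]mulmx_ebase rank_rV v0.
    rewrite [col_ebase v]mx11_scalar -mulmxA mul_scalar_mx rowE.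
    rewrite mxE; congr (_ *: (_ *m _)); apply/matrixP => i j.
    by rewrite !mxE ord1 /= andbT eq_sym.
  have : v *m S *m v^T = c ^+ 2 *:
      (row ord0 (row_ebase v *m S *m (row_ebase v)^T) *m delta_mx ord0 0).
    rewrite {1 2}vE linearZ /= -!scalemxAl -scalemxAr scalerA -expr2.
    congr (_ *: _).
    by rewrite !row_mul -mulmxA -colE tr_row.
  move=> eqv; move: qv; rewrite eqv mxE mulf_eq0 negb_or => /andP[_].
  by rewrite -colE !mxE.
have [i [j Sij]] : exists i j, S i j != 0.
  case: (pickP (fun ij => S ij.1 ij.2 != 0)) => [[i j] ij0|S00].
    by exists i, j.
  case/eqP: S0; apply/matrixP => i j; rewrite mxE.
  by have /negbFE/eqP := S00 (i, j).
have [Sii|] := eqVneq (S i i) 0; last by rewrite -delta_mx_form; apply: entry.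
have [Sjj|] := eqVneq (S j j) 0; last by rewrite -delta_mx_form; apply: entry.
have addE (A B : 'M[F]_1) : (A + B) 0 0 = A 0 0 + B 0 0 by rewrite mxE.
(* With both diagonal entries zero, the form takes the value 2 S_ij at e_i + e_j; here the
   characteristic matters. *)
apply: (entry (delta_mx 0 i + delta_mx 0 j)).
rewrite linearD /= !(mulmxDl, mulmxDr) !addE !delta_mx_form Sii Sjj.
have -> : S j i = S i j by rewrite -[in LHS]symS mxE.
by rewrite add0r addr0 -mulr2n -mulr_natl mulf_neq0.
Qed.

(** Symmetric Gaussian elimination: a nonzero corner [p] clears its row and column by the shear [L],
    and the induction continues on the Schur complement [C]. *)
Lemma congr_diag n (S : 'M[F]_n) : S^T = S ->
  exists2 W, W \in unitmx & is_diag_mx (W *m S *m W^T).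
Proof.
elim: n S => [|n IHn] S symS.
  exists 1%:M; first exact: unitmx1.
  by apply/is_diag_mxP => -[].
have [->|S0] := eqVneq S 0.
  by exists 1%:M; rewrite ?unitmx1 // mulmx0 mul0mx mx0_is_diag.
have [W Wu p0] := congr_anisotropic symS S0.
suff [V Vu VT] : exists2 V, V \in unitmx &
    is_diag_mx ((V : 'M[F]_(1 + n)) *m (W *m S *m W^T : 'M[F]_(1 + n)) *m V^T).
  exists (V *m W : 'M[F]_n.+1); first by rewrite unitmx_mul Vu.
  by move: VT; rewrite trmx_mul !mulmxA.
have symT : (W *m S *m W^T)^T = W *m S *m W^T.
  by rewrite !trmx_mul trmxK symS mulmxA.
move: {W Wu S S0 symS} (W *m S *m W^T : 'M[F]_(1 + n)) symT p0 => T symT p0.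
pose p := T 0 0; pose b := dlsubmx T.
have TE : T = block_mx p%:M b^T b (drsubmx T).
  rewrite -[LHS]submxK; congr block_mx.
    by rewrite [LHS]mx11_scalar !mxE; congr (T _ _)%:M; apply/val_inj.
  by rewrite /b trmx_dlsub symT.
pose C := drsubmx T - p^-1 *: (b *m b^T).
have symC : C^T = C.
  by rewrite linearB linearZ /= trmx_mul trmxK trmx_drsub symT.
have [Z Zu ZC] := IHn C symC.
pose L : 'M[F]_(1 + n) := block_mx 1%:M 0 (- p^-1 *: b) 1%:M.
pose D : 'M[F]_(1 + n) := block_mx 1%:M 0 0 Z.
exists (D *m L).
  by rewrite unitmx_mul !unitmxE !det_lblock !det1 !mul1r -unitmxE Zu unitr1.
have -> : D *m L *m T *m (D *m L)^T = block_mx p%:M 0 0 (Z *m C *m Z^T).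
  rewrite TE trmx_mul !tr_block_mx !trmx1 !trmx0.
  rewrite mulmx_block !(mul0mx, mul1mx, mulmx0, mulmx1, addr0, add0r).
  rewrite mulmx_block !(mul0mx, mul1mx, mulmx0, mulmx1, addr0, add0r).
  have pb : - p^-1 *: b *m p%:M = - b.
    by rewrite mul_mx_scalar scalerA mulrN divff // scaleN1r.
  have bp : p%:M *m (- p^-1 *: b)^T = - b^T.
    by rewrite linearZ mul_scalar_mx /= scalerA mulrN divff // scaleN1r.
  rewrite -[Z *m _ *m p%:M]mulmxA pb mulmxN addNr.
  rewrite mulmxA mulmx_block !(mul0mx, mul1mx, mulmx0, mulmx1, addr0, add0r).
  rewrite mulmx_block !(mul0mx, mul1mx, mulmx0, mulmx1, addr0, add0r).
  rewrite bp addNr mul0mx; congr (block_mx _ _ _ (_ *m _)).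
  by rewrite -mulmxA -mulmxDr /C scaleNr mulNmx -scalemxAl addrC.
rewrite is_diag_block_mx // !eqxx ZC !andbT.
exact: scalar_mx_is_diag.
Qed.
End Congruence.

(** * Normal forms of three-dimensional Lie algebras *)

Section NormalForms.
Variable R : realType.
Implicit Types (M N U V W : 'M[R]_3) (x y : 'cV[R]_3).
Implicit Types (a b c d r : R).

(* The symmetric part diag(d0, d1, d2) plus the cross-product matrix of
   (a0, a1, a2). *)
Definition lie3 (d0 d1 d2 a0 a1 a2 : R) :=
  mx3 d0 (- a2) a1 a2 d1 (- a0) (- a1) a0 d2.

Lemma diag3E a b c : diag3 a b c = lie3 a b c 0 0 0.
Proof. by rewrite /lie3 oppr0. Qed.

Lemma opp_diag3 a b c : - diag3 a b c = diag3 (- a) (- b) (- c).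
Proof. by rewrite -scaleN1r /diag3 scale_mx3 !mulN1r oppr0. Qed.

Lemma lie3_of_diag_sym M : is_lie (brM M) -> is_diag_mx (M + M^T) ->
  exists d0 d1 d2 a0 a1 a2, M = lie3 d0 d1 d2 a0 a1 a2 /\
    [/\ d0 * a0 = 0, d1 * a1 = 0 & d2 * a2 = 0].
Proof.
move=> lieM /is_diag_mxP diagM; have := jacobi_axial lieM.
have off i j : val i != val j -> M i j = - M j i.
  by move=> /diagM; rewrite !mxE => /eqP; rewrite addr_eq0 => /eqP.
have M01 : M i0 i1 = - M i1 i0 by apply: off; rewrite /= !inord3K.
have M20 : M i2 i0 = - M i0 i2 by apply: off; rewrite /= !inord3K.
have M12 : M i1 i2 = - M i2 i1 by apply: off; rewrite /= !inord3K.
move=> /matrixP J.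
exists (M i0 i0), (M i1 i1), (M i2 i2), (M i2 i1), (M i0 i2), (M i1 i0).
split; first by rewrite [LHS]mx3P M01 M20 M12.
(* [axial M] is twice the vector a, and its antisymmetric contribution is a × a = 0, so the i-th
   component of [J] is 2 d_i a_i. *)
have two : (2 : R) != 0 by rewrite pnatr_eq0.
split; apply: (mulfI two).
- have := J i0 0; rewrite !mxE sum_ord3 !axialE M01 M20 M12 => J0.
  by rewrite mulr0 -J0; ring.
- have := J i1 0; rewrite !mxE sum_ord3 !axialE M01 M20 M12 => J0.
  by rewrite mulr0 -J0; ring.
- have := J i2 0; rewrite !mxE sum_ord3 !axialE M01 M20 M12 => J0.
  by rewrite mulr0 -J0; ring.
Qed.

Lemma eqv_lie3 M : is_lie (brM M) ->
  exists d0 d1 d2 a0 a1 a2, eqv M (lie3 d0 d1 d2 a0 a1 a2) /\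
    [/\ d0 * a0 = 0, d1 * a1 = 0 & d2 * a2 = 0].
Proof.
move=> lieM; have two : (2 : R) != 0 by rewrite pnatr_eq0.
have symS : (M + M^T)^T = M + M^T by rewrite linearD /= trmxK addrC.
have [W Wu diagW] := congr_diag two symS.
(* Acting by [invmx W] turns [M] into a multiple of W M W^T, whose symmetric part is diagonal by the
   choice of [W]. *)
pose N := act_mx (invmx W) M.
have Uu : invmx W \in unitmx by rewrite unitmx_inv.
have eqN := act_mxE M Uu.
have lieN : is_lie (brM N) by rewrite -(conj_brM Uu eqN); exact: is_lie_conj.
have diagN : is_diag_mx (N + N^T).
  rewrite /N /act_mx invmxK linearZ /= !trmx_mul trmxK mulmxA -scalerDr.
  rewrite -mulmxDl -mulmxDr.
  apply/is_diag_mxP => i j /(is_diag_mxP diagW) Wij.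
  by rewrite mxE Wij mulr0.
have [d0 [d1 [d2 [a0 [a1 [a2 [NE da]]]]]]] := lie3_of_diag_sym lieN diagN.
by exists d0, d1, d2, a0, a1, a2; split; rewrite // -NE; apply: eqv_act_mx.
Qed.

(** Serves to certify explicit base changes: the determinant is supplied as a closed form [t], which
    leaves only ring or field identities. *)
Lemma eqv_mx3 (a b c d e f g h k t : R) M N (U := mx3 a b c d e f g h k) :
  t != 0 ->
  t = a * (e * k - f * h) - b * (d * k - f * g) + c * (d * h - e * g) ->
  U *m N *m U^T = t *: M -> eqv M N.
Proof.
by move=> t0; rewrite -det_mx3 => tE eqU; exists U;
  rewrite ?unitmxE ?unitfE -/U -tE.
Qed.

Lemma eqv_rot d0 d1 d2 a0 a1 a2 :
  eqv (lie3 d0 d1 d2 a0 a1 a2) (lie3 d1 d2 d0 a1 a2 a0).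
Proof.
apply: (@eqv_mx3 0 0 1 1 0 0 0 1 0 1); [exact: oner_neq0 | ring |].
rewrite /lie3 tr_mx3 !mul_mx3 scale_mx3; congr mx3; ring.
Qed.

Lemma eqv_swap12 d0 d1 d2 a0 :
  eqv (lie3 d0 d1 d2 a0 0 0) (lie3 d0 d2 d1 a0 0 0).
Proof.
apply: (@eqv_mx3 1 0 0 0 0 1 0 (-1) 0 1); [exact: oner_neq0 | ring |].
rewrite /lie3 tr_mx3 !mul_mx3 scale_mx3; congr mx3; ring.
Qed.

Lemma eqv_swap01 d0 d1 d2 : eqv (diag3 d0 d1 d2) (diag3 d1 d0 d2).
Proof.
rewrite !diag3E; apply: eqv_trans (eqv_rot _ _ _ _ _ _) _.
exact: eqv_swap12.
Qed.

Lemma eqv_opp M : eqv M (- M).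
Proof.
have cube : (-1 : R) ^+ 3 = -1 by ring.
exists (-1)%:M.
  by rewrite unitmxE det_scalar unitfE cube oppr_eq0 oner_neq0.
rewrite det_scalar cube tr_scalar_mx mul_mx_scalar mul_scalar_mx.
by rewrite !scaleN1r opprK.
Qed.

(* d1 a1 = d2 a2 = 0 makes the shear that turns a into a multiple of e_0 fix
   the symmetric part. *)
Lemma eqv_shear d0 d1 d2 a0 a1 a2 : a0 != 0 ->
  d0 * a0 = 0 -> d1 * a1 = 0 -> d2 * a2 = 0 ->
  eqv (lie3 d0 d1 d2 a0 a1 a2) (lie3 0 d1 d2 a0 0 0).
Proof.
move=> a00 /eqP; rewrite mulf_eq0 (negPf a00) orbF => /eqP -> da1 da2.
have [k1 a1E] : exists k, a1 = k * a0 by exists (a1 / a0); rewrite divfK.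
have [k2 a2E] : exists k, a2 = k * a0 by exists (a2 / a0); rewrite divfK.
move: da1 da2; rewrite a1E a2E !mulrA => /eqP.
rewrite mulf_eq0 (negPf a00) orbF => /eqP dk1 /eqP.
rewrite mulf_eq0 (negPf a00) orbF => /eqP dk2.
apply: (@eqv_mx3 1 (- k1) (- k2) 0 1 0 0 0 1 1); [exact: oner_neq0 | ring |].
rewrite /lie3 tr_mx3 !mul_mx3 scale_mx3; congr mx3; ring: dk1 dk2.
Qed.

Lemma eqv_diag3_scale r0 r1 r2 d0 d1 d2 : r0 != 0 -> r1 != 0 -> r2 != 0 ->
  eqv (diag3 (d0 * r0 ^+ 2) (d1 * r1 ^+ 2) (d2 * r2 ^+ 2)) (diag3 d0 d1 d2).
Proof.
move=> r00 r10 r20.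
(* The diagonal entries u_i of the base change solve u_i^2 = det(U) r_i^2. *)
apply: (@eqv_mx3 (r1 * r2)^-1 0 0 0 (r0 * r2)^-1 0 0 0 (r0 * r1)^-1
    ((r0 * r1 * r2) ^- 2)).
- by rewrite invr_neq0 ?expf_neq0 // !mulf_neq0.
- by field; rewrite r00 r10 r20.
rewrite /diag3 tr_mx3 !mul_mx3 scale_mx3; congr mx3; field;
  rewrite ?r00 ?r10 ?r20 //.
Qed.

(* In order: the abelian algebra, h3, e(2), e(1,1), so(3), sl(2,R), and the two
   kinds of non-unimodular algebras, the last one with one parameter. *)
Variant normal_form : 'M[R]_3 -> Prop :=
  | NF000 : normal_form (diag3 0 0 0)
  | NF100 : normal_form (diag3 1 0 0)
  | NF110 : normal_form (diag3 1 1 0)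
  | NF11'0 : normal_form (diag3 1 (-1) 0)
  | NF111 : normal_form (diag3 1 1 1)
  | NF111' : normal_form (diag3 1 1 (-1))
  | NFE00 : normal_form (lie3 0 0 0 1 0 0)
  | NFE1 h : normal_form (lie3 0 1 h 1 0 0).

Definition has_nf M := exists2 N, eqv M N & normal_form N.

Lemma eqv_has_nf M N : eqv M N -> has_nf N -> has_nf M.
Proof.
by move=> eqMN [K eqNK nfK]; exists K => //; apply: eqv_trans eqMN _.
Qed.

Lemma normal_form_has_nf N : normal_form N -> has_nf N.
Proof. by exists N => //; apply: eqv_refl. Qed.

Lemma sg_square (d : R) : exists r s, [/\ r != 0, d = s * r ^+ 2 &
  [\/ s = 0, s = 1 | s = -1]].
Proof.
have [->|d0] := eqVneq d 0.
  by exists 1, 0; rewrite oner_neq0 mul0r; split => //; constructor.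
exists (Num.sqrt `|d|), (Num.sg d); split.
- by rewrite sqrtr_eq0 -ltNge normr_gt0.
- by rewrite sqr_sqrtr // -numEsg.
by case: sgrP d0; rewrite ?eqxx // => _ _; constructor.
Qed.

(** After scaling, 27 sign patterns remain; permutations and an overall sign change reduce them to
    the six diagonal normal forms. *)
Lemma diag3_has_nf d0 d1 d2 : has_nf (diag3 d0 d1 d2).
Proof.
have [r0 [s0 [r00 -> s0E]]] := sg_square d0.
have [r1 [s1 [r10 -> s1E]]] := sg_square d1.
have [r2 [s2 [r20 -> s2E]]] := sg_square d2.
apply: eqv_has_nf (eqv_diag3_scale _ _ _ r00 r10 r20) _.
have swap01 a b c : has_nf (diag3 b a c) -> has_nf (diag3 a b c).
  by apply: eqv_has_nf; apply: eqv_swap01.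
have swap12 a b c : has_nf (diag3 a c b) -> has_nf (diag3 a b c).
  by apply: eqv_has_nf; rewrite !diag3E; apply: eqv_swap12.
have opp a b c : has_nf (diag3 (- a) (- b) (- c)) -> has_nf (diag3 a b c).
  by apply: eqv_has_nf; rewrite -opp_diag3; apply: eqv_opp.
case: s0E => ->; case: s1E => ->; case: s2E => ->.
all: let nf := (by apply: normal_form_has_nf; constructor) in
  let nf_opp := first [nf | apply: opp; rewrite ?opprK ?oppr0; nf] in
  first [nf_opp | apply: swap01; nf_opp | apply: swap12; nf_opp
  | apply: swap01; apply: swap12; nf_opp | apply: swap12; apply: swap01; nf_opp
  | apply: swap01; apply: swap12; apply: swap01; nf_opp].
Qed.


Lemma lie3_has_nf d1 d2 a0 : a0 != 0 -> has_nf (lie3 0 d1 d2 a0 0 0).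
Proof.
move=> a00.
have norm e1 e2 : e1 != 0 -> has_nf (lie3 0 e1 e2 a0 0 0).
  (* Diagonal rescalings leave the ratio d1 d2 / a0^2 fixed, so it becomes the parameter once a0 and
     d1 are normalised to 1. *)
  move=> e10; exists (lie3 0 1 (e1 * e2 / a0 ^+ 2) 1 0 0); last by constructor.
  apply: (@eqv_mx3 a0^-1 0 0 0 1 0 0 0 (a0 / e1) e1^-1).
  - by rewrite invr_neq0.
  - by field; rewrite a00 e10.
  rewrite /lie3 tr_mx3 !mul_mx3 scale_mx3; congr mx3; field;
    rewrite ?a00 ?e10 //.
have [->|d10] := eqVneq d1 0; last exact: norm.
have [->|d20] := eqVneq d2 0; last first.
  by apply: eqv_has_nf (eqv_swap12 _ _ _ _) _; apply: norm.
exists (lie3 0 0 0 1 0 0); last by constructor.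
apply: (@eqv_mx3 a0^-1 0 0 0 1 0 0 0 1 a0^-1).
- by rewrite invr_neq0.
- by field; rewrite a00.
rewrite /lie3 tr_mx3 !mul_mx3 scale_mx3; congr mx3; field; rewrite ?a00 //.
Qed.

Lemma lie_has_nf M : is_lie (brM M) -> has_nf M.
Proof.
move=> /eqv_lie3 [d0 [d1 [d2 [a0 [a1 [a2 [eqM [da0 da1 da2]]]]]]]].
apply: eqv_has_nf eqM _.
have nf0 e0 e1 e2 b0 b1 b2 : e0 * b0 = 0 -> e1 * b1 = 0 -> e2 * b2 = 0 ->
    b0 != 0 -> has_nf (lie3 e0 e1 e2 b0 b1 b2).
  move=> eb0 eb1 eb2 b00; apply: eqv_has_nf (eqv_shear b00 eb0 eb1 eb2) _.
  exact: lie3_has_nf.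
have [a00|a00] := eqVneq a0 0; last exact: nf0.
have [a10|a10] := eqVneq a1 0; last first.
  by apply: eqv_has_nf (eqv_rot _ _ _ _ _ _) _; apply: nf0.
have [a20|a20] := eqVneq a2 0; last first.
  by do 2 (apply: eqv_has_nf (eqv_rot _ _ _ _ _ _) _); apply: nf0.
by rewrite a00 a10 a20 -diag3E; apply: diag3_has_nf.
Qed.

End NormalForms.

(** * Limits of matrices *)

Section MatrixLimits.
Local Open Scope classical_set_scope.
Variable K : realFieldType.
Context {T : Type} (F : set_system T) {FF : Filter F}.

Lemma cvg_mxP m n (A : T -> 'M[K]_(m, n)) (A0 : 'M[K]_(m, n)) :
  A t @[t --> F] --> A0 <-> forall i j, A t i j @[t --> F] --> A0 i j.
Proof.
split=> [cA i j|cA].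
  exact: (continuous_cvg _ (@coord_continuous K m n i j A0) cA).
apply/cvg_ballP => e e0; near=> t; split => //; near: t.
apply: filter_forall => i; apply: filter_forall => j.
by move/cvg_ballP: (cA i j) => /(_ e e0).
Unshelve. all: by end_near.
Qed.

Lemma cvg_mulmx m n p (A : T -> 'M[K]_(m, n)) (B : T -> 'M[K]_(n, p))
    (A0 : 'M[K]_(m, n)) (B0 : 'M[K]_(n, p)) :
  A t @[t --> F] --> A0 -> B t @[t --> F] --> B0 ->
  A t *m B t @[t --> F] --> A0 *m B0.
Proof.
move=> /cvg_mxP cA /cvg_mxP cB; apply/cvg_mxP => i j.
under eq_fun do rewrite mxE; rewrite mxE.
by apply: cvg_big => [|k _]; [exact: add_continuous|]; apply: cvgM.
Qed.

Lemma cvg_mxtrace n (A : T -> 'M[K]_n) (A0 : 'M[K]_n) :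
  A t @[t --> F] --> A0 -> \tr (A t) @[t --> F] --> \tr A0.
Proof.
by move=> /cvg_mxP cA; apply: cvg_big => [|k _]; [exact: add_continuous|].
Qed.

Lemma cvg_det n (A : T -> 'M[K]_n) (A0 : 'M[K]_n) :
  A t @[t --> F] --> A0 -> \det (A t) @[t --> F] --> \det A0.
Proof.
move=> /cvg_mxP cA; apply: cvg_big => [|s _]; first exact: add_continuous.
apply: cvgM; first exact: cvg_cst.
by apply: cvg_big => [|k _]; [exact: mul_continuous|exact: cA].
Qed.

End MatrixLimits.

(** * Degenerations and their invariants *)

Section Degeneration.
Local Open Scope classical_set_scope.
Variable R : realType.
Implicit Types (M N U V W : 'M[R]_3) (x y : 'cV[R]_3).

Definition ad M x := M *m cross_mx x.
Definition killing M x y := \tr (ad M x *m ad M y).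

Lemma ad_conj M N U x : U \in unitmx -> U *m N *m U^T = \det U *: M ->
  U *m ad N x = ad M (U *m x) *m U.
Proof.
move=> Uu eqU; have dU : \det U != 0 by rewrite -unitfE -unitmxE.
apply: (scalerI dU); rewrite /ad mulmxA scalemxAr -cross_mx_mul !mulmxA eqU.
by rewrite -!scalemxAl.
Qed.

Lemma killing_conj M N U x y : U \in unitmx -> U *m N *m U^T = \det U *: M ->
  killing N x y = killing M (U *m x) (U *m y).
Proof.
move=> Uu eqU; rewrite /killing -[in RHS](mulmxK Uu (_ *m _)).
rewrite -[ad M _ *m _ *m U]mulmxA -(ad_conj _ Uu eqU) mulmxA.
rewrite -(ad_conj _ Uu eqU).
by rewrite [RHS]mxtrace_mulC -mulmxA mulKmx.
Qed.

Lemma trad_conj M N U x : U \in unitmx -> U *m N *m U^T = \det U *: M ->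
  \tr (ad N x) = \tr (ad M (U *m x)).
Proof.
move=> Uu eqU; rewrite -[ad M _](mulmxK Uu) -(ad_conj _ Uu eqU).
by rewrite [RHS]mxtrace_mulC mulKmx.
Qed.

(* M0 lies in the closure of the orbit of M, along a curve. *)
Definition degen M M0 := exists F : R -> 'M[R]_3,
  (forall e, 0 < e <= 1 -> eqv M (F e)) /\ F e @[e --> 0^'+] --> M0.

Lemma near_right01 : \forall e \near (0 : R)^'+, 0 < e <= 1.
Proof.
near=> e; apply/andP; split; near: e; first exact: nbhs_right_gt.
exact: nbhs_right_le.
Unshelve. all: by end_near.
Qed.

(** Column j of a structure matrix is the bracket of two fixed vectors whose cross product is e_j,
    so pointwise convergence of brackets gives convergence of matrices. *)
Lemma contraction_act_mx M M0 (U : R -> 'M[R]_3) :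
  contracts_via (brM M) U (brM M0) -> act_mx (U e) M @[e --> 0^'+] --> M0.
Proof.
move=> [Uu _ cvgU]; apply/cvg_mxP => i j; have [x [y xyj]] := so3_span R j.
have colM N : N i j = brM N x y i 0 by rewrite /brM xyj -colE mxE.
rewrite colM; move/cvg_mxP: (cvgU x y) => /(_ i 0); apply: cvg_trans.
apply: near_eq_cvg; near=> e; have Ue : U e \in unitmx.
  by apply: Uu; near: e; exact: near_right01.
by rewrite colM -(conj_brM Ue (act_mxE M Ue)).
Unshelve. all: by end_near.
Qed.

Lemma contraction_degen M M0 (U : R -> 'M[R]_3) :
  contracts_via (brM M) U (brM M0) -> degen M M0.
Proof.
move=> ctr; exists (fun e => act_mx (U e) M).
split; last exact: contraction_act_mx.
by case: ctr => Uu _ _ e /Uu; apply: eqv_act_mx.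
Qed.

(** The general closedness principle: [f] and [g] need not be invariant separately, only the
    inequality has to hold on the whole orbit. *)
Lemma degen_le M M0 (f g : 'M[R]_3 -> R) : degen M M0 ->
  (forall F : R -> 'M[R]_3, F e @[e --> 0^'+] --> M0 ->
     f (F e) @[e --> 0^'+] --> f M0) ->
  (forall F : R -> 'M[R]_3, F e @[e --> 0^'+] --> M0 ->
     g (F e) @[e --> 0^'+] --> g M0) ->
  (forall N, eqv M N -> f N <= g N) -> f M0 <= g M0.
Proof.
move=> [F [eqF cF]] cf cg lefg; apply: ler_cvg_to (cf _ cF) (cg _ cF) _.
near=> e; apply/lefg/eqF; near: e; exact: near_right01.
Unshelve. all: by end_near.
Qed.

Lemma degen_eq M M0 (f g : 'M[R]_3 -> R) : degen M M0 ->
  (forall F : R -> 'M[R]_3, F e @[e --> 0^'+] --> M0 ->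
     f (F e) @[e --> 0^'+] --> f M0) ->
  (forall F : R -> 'M[R]_3, F e @[e --> 0^'+] --> M0 ->
     g (F e) @[e --> 0^'+] --> g M0) ->
  (forall N, eqv M N -> f N = g N) -> f M0 = g M0.
Proof.
move=> dM cf cg eqfg; apply/eqP; rewrite eq_le; apply/andP; split.
  by apply: (degen_le dM cf cg) => N /eqfg ->.
by apply: (degen_le dM cg cf) => N /eqfg ->.
Qed.

Lemma cvg_killing (F : R -> 'M[R]_3) M0 x y : F e @[e --> 0^'+] --> M0 ->
  killing (F e) x y @[e --> 0^'+] --> killing M0 x y.
Proof.
move=> cF; apply: cvg_mxtrace.
by apply: cvg_mulmx; apply: cvg_mulmx => //; exact: cvg_cst.
Qed.

Lemma cvg_trad (F : R -> 'M[R]_3) M0 x : F e @[e --> 0^'+] --> M0 ->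
  \tr (ad (F e) x) @[e --> 0^'+] --> \tr (ad M0 x).
Proof.
by move=> cF; apply: cvg_mxtrace; apply: cvg_mulmx => //; exact: cvg_cst.
Qed.

Lemma cvg_entry (F : R -> 'M[R]_3) M0 i j : F e @[e --> 0^'+] --> M0 ->
  F e i j @[e --> 0^'+] --> M0 i j.
Proof. by move/cvg_mxP. Qed.

(** Congruence and scaling preserve the relation, which is closed. The values c = 1 and c = -1 give
    symmetry and antisymmetry. *)
Lemma degen_sym M M0 c : degen M M0 -> M^T = c *: M -> M0^T = c *: M0.
Proof.
move=> dM symM; apply/matrixP => i j; rewrite !mxE.
apply: (degen_eq (f := fun M => M j i) (g := fun M => c * M i j) dM).
- by move=> F; apply: cvg_entry.
- by move=> F cF; apply: cvgM; [exact: cvg_cst | exact: cvg_entry].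
move=> N [U Uu eqU]; suff : N^T = c *: N.
  by move/matrixP => /(_ i j); rewrite !mxE.
apply: (can_inj (mulKmx Uu)); apply: (can_inj (mulmxK (_ : U^T \in unitmx))).
  by rewrite unitmx_tr.
rewrite -scalemxAr -scalemxAl eqU scalerA mulrC -scalerA -symM.
rewrite -linearZ /= -eqU.
by rewrite !trmx_mul trmxK mulmxA.
Qed.

Lemma degen_det0 M M0 : degen M M0 -> \det M = 0 -> \det M0 = 0.
Proof.
move=> dM det0; apply: (degen_eq (f := fun M => \det M) (g := fun=> 0) dM).
- by move=> F; apply: cvg_det.
- by move=> F _; apply: cvg_cst.
move=> N [U Uu /(congr1 (fun A => \det A))].
rewrite !det_mulmx detZ det0 mulr0 det_tr => /eqP; rewrite !mulf_eq0.
by have := Uu; rewrite unitmxE unitfE => /negPf ->; rewrite orbF => /eqP.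
Qed.

(** A change of basis only replaces [x] by [U x] on both sides, so the constant [c] is shared by the
    whole orbit and survives in the limit. *)
Lemma degen_killing_trad M M0 c : degen M M0 ->
  (forall x, killing M x x = c * \tr (ad M x) ^+ 2) ->
  forall x, killing M0 x x = c * \tr (ad M0 x) ^+ 2.
Proof.
move=> dM kM x; apply: (degen_eq (f := fun M => killing M x x)
  (g := fun M => c * \tr (ad M x) ^+ 2) dM).
- by move=> F; apply: cvg_killing.
- move=> F cF; apply: cvgM; first exact: cvg_cst.
  by rewrite expr2; apply: cvgM; exact: cvg_trad.
move=> N [U Uu eqU].
by rewrite (killing_conj _ _ Uu eqU) (trad_conj _ Uu eqU) kM.
Qed.

Lemma degen_killing_le0 M M0 : degen M M0 ->
  (forall x, killing M x x <= 0) -> forall x, killing M0 x x <= 0.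
Proof.
move=> dM kM x.
apply: (degen_le (f := fun M => killing M x x) (g := fun=> 0) dM).
- by move=> F; apply: cvg_killing.
- by move=> F _; apply: cvg_cst.
by move=> N [U Uu eqU]; rewrite (killing_conj _ _ Uu eqU).
Qed.

Lemma degen_killing_ge0 M M0 : degen M M0 ->
  (forall x, 0 <= killing M x x) -> forall x, 0 <= killing M0 x x.
Proof.
move=> dM kM x.
apply: (degen_le (f := fun=> 0) (g := fun M => killing M x x) dM).
- by move=> F _; apply: cvg_cst.
- by move=> F; apply: cvg_killing.
by move=> N [U Uu eqU]; rewrite (killing_conj _ _ Uu eqU).
Qed.

(** The premise is strict, hence open: it passes from the limit back to the curve for small e, where
    the inequality is available. *)
Lemma degen_reverse_CS M M0 : degen M M0 ->
  (forall x y, killing M x x < 0 ->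
     killing M x x * killing M y y <= killing M x y ^+ 2) ->
  forall x y, killing M0 x x < 0 ->
     killing M0 x x * killing M0 y y <= killing M0 x y ^+ 2.
Proof.
move=> [F [eqF cF]] kM x y kx.
have cl : killing (F e) x x * killing (F e) y y @[e --> 0^'+] -->
    killing M0 x x * killing M0 y y by apply: cvgM; exact: cvg_killing.
have cr : killing (F e) x y * killing (F e) x y @[e --> 0^'+] -->
    killing M0 x y * killing M0 x y by apply: cvgM; exact: cvg_killing.
have ck := @cvg_killing F M0 x x cF.
rewrite expr2; apply: (ler_cvg_to cl cr).
near=> e; have [|U Uu eqU] := eqF e.
  by near: e; exact: near_right01.
rewrite !(killing_conj _ _ Uu eqU) -expr2; apply: kM.
rewrite -(killing_conj _ _ Uu eqU); near: e.
exact: (cvgr_lt (killing M0 x x) ck 0 kx).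
Unshelve. all: by end_near.
Qed.

Lemma degen_eqvl M N M0 : eqv M N -> degen N M0 -> degen M M0.
Proof.
move=> eqMN [F [eqF cF]]; exists F; split => // e /eqF; exact: eqv_trans.
Qed.

Lemma degen_eqvr M N M0 : degen M N -> eqv N M0 -> degen M M0.
Proof.
move=> [F [eqF cF]] [U Uu eqU]; exists (fun e => act_mx U (F e)).
split=> [e /eqF /eqv_trans|]; first by apply; apply: eqv_act_mx.
have Ut : U^T \in unitmx by rewrite unitmx_tr.
have -> : M0 = act_mx U N.
  apply: (can_inj (mulKmx Uu)); apply: (can_inj (mulmxK Ut)).
  by rewrite eqU act_mxE.
rewrite /act_mx; under eq_fun do rewrite scalemxAl scalemxAl.
rewrite !scalemxAl.
by apply: cvg_mulmx; [apply: cvg_mulmx => //|]; exact: cvg_cst.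
Qed.

End Degeneration.

(** * Diagonal one-parameter weights *)

Section Table.
Variable R : realType.
Implicit Types (M N U V W : 'M[R]_3) (x y : 'cV[R]_3).
Implicit Types (a b c d t u v w : R).

Definition vec3 u v w : 'cV[R]_3 := \col_i nth 0 [:: u; v; w] i.

Lemma vec3E u v w : (vec3 u v w i0 0 = u) * (vec3 u v w i1 0 = v) *
  (vec3 u v w i2 0 = w).
Proof. by rewrite !mxE !inord3K. Qed.

Lemma killing_diag3 a b c x y : killing (diag3 a b c) x y =
  - 2 * (b * c * (x i0 0 * y i0 0) + a * c * (x i1 0 * y i1 0)
         + a * b * (x i2 0 * y i2 0)).
Proof.
rewrite /killing /ad /diag3 /cross_mx !mul_mx3 /mxtrace sum_ord3 !mx3E; ring.
Qed.

Lemma trad_diag3 a b c x : \tr (ad (diag3 a b c) x) = 0.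
Proof.
rewrite /ad /diag3 /cross_mx !mul_mx3 /mxtrace sum_ord3 !mx3E; ring.
Qed.

Lemma killing_lie3 b c t x :
  killing (lie3 0 b c t 0 0) x x = 2 * (t ^+ 2 - b * c) * x i0 0 ^+ 2.
Proof.
rewrite /killing /ad /lie3 /cross_mx !mul_mx3 /mxtrace sum_ord3 !mx3E; ring.
Qed.

Lemma trad_lie3 b c t x :
  \tr (ad (lie3 0 b c t 0 0) x) = - 2 * t * x i0 0.
Proof.
rewrite /ad /lie3 /cross_mx !mul_mx3 /mxtrace sum_ord3 !mx3E; ring.
Qed.

(* Under diag(e^alpha) the entry N i j is multiplied by e to the power
   alpha_0 + alpha_1 + alpha_2 - alpha_i - alpha_j. *)
Definition weights_bounded (alpha : 'I_3 -> nat) N := forall i j,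
  N i j != 0 -> (alpha i + alpha j <= \sum_k alpha k)%N.

Definition weight_limit (alpha : 'I_3 -> nat) N : 'M[R]_3 := \matrix_(i, j)
  if (alpha i + alpha j == \sum_k alpha k)%N then N i j else 0.

(** The algebraic content of a diagonal contraction: P is the base change from [M] to [N], and Q is
    absorbed in the final equivalence. *)
Definition weight_contracts (k : nat) M M0 := exists alpha N,
  [/\ forall i, (alpha i <= k)%N, eqv M N, weights_bounded alpha N &
      eqv (weight_limit alpha N) M0].

Definition exps (p q r : nat) (i : 'I_3) := nth 0%N [:: p; q; r] i.

Lemma expsE p q r : (exps p q r i0 = p) * (exps p q r i1 = q) *
  (exps p q r i2 = r).
Proof. by rewrite /exps !inord3K. Qed.

(** The diagonal entries have exponents s - 2p, s - 2q and s - 2r. The entries ±t have exponent p,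
    so they are never unbounded and survive only when p = 0. *)
Lemma weight_contracts_lie3 (p q r k : nat) M M0 d0 d1 d2 t
    (s := (p + q + r)%N) : (p <= k)%N -> (q <= k)%N -> (r <= k)%N ->
  eqv M (lie3 d0 d1 d2 t 0 0) ->
  (2 * p <= s)%N || (d0 == 0) -> (2 * q <= s)%N || (d1 == 0) ->
  (2 * r <= s)%N || (d2 == 0) ->
  eqv (lie3 (if (2 * p == s)%N then d0 else 0)
    (if (2 * q == s)%N then d1 else 0) (if (2 * r == s)%N then d2 else 0)
    (if p == 0%N then t else 0) 0 0) M0 ->
  weight_contracts k M M0.
Proof.
move=> pk qk rk eqMN h0 h1 h2 eqM0; exists (exps p q r), (lie3 d0 d1 d2 t 0 0).
have sE : (\sum_k exps p q r k = s)%N by rewrite sum_ord3 !expsE.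
split=> //; first by elim/ord3P; rewrite expsE.
- rewrite /weights_bounded sE; elim/ord3P; elim/ord3P;
    rewrite !mx3E !expsE ?oppr0 ?eqxx // ?addnn -?mul2n /s => nz;
    first [by move: h0 h1 h2; rewrite (negPf nz) ?orbF | lia].
suff -> : weight_limit (exps p q r) (lie3 d0 d1 d2 t 0 0) =
    (lie3 (if (2 * p == s)%N then d0 else 0) (if (2 * q == s)%N then d1 else 0)
    (if (2 * r == s)%N then d2 else 0) (if p == 0%N then t else 0) 0 0) by [].
have s0 : (q + r == s)%N = (p == 0)%N by rewrite /s; lia.
have s0' : (r + q == s)%N = (p == 0)%N by rewrite /s; lia.
apply/matrixP; elim/ord3P; elim/ord3P; rewrite mxE sE !mx3E !expsE ?addnn;
  rewrite -?mul2n ?s0 ?s0' ?oppr0 ?if_same //.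
by case: ifP; rewrite ?oppr0.
Qed.

Lemma weight_contracts_id M : weight_contracts 1 M M.
Proof.
exists (fun=> 0%N), M; split=> //; first exact: eqv_refl.
suff -> : weight_limit (fun=> 0%N) M = M by exact: eqv_refl.
by apply/matrixP => i j; rewrite mxE sum_ord3.
Qed.

(** With all exponents 1 every entry has exponent 3 - 2 = 1 and tends to zero. *)
Lemma weight_contracts0 M : weight_contracts 1 M (diag3 0 0 0).
Proof.
exists (fun=> 1%N), M; split=> //; first exact: eqv_refl.
  by move=> i j _; rewrite sum_ord3.
suff -> : weight_limit (fun=> 1%N) M = diag3 0 0 0 by exact: eqv_refl.
by rewrite [LHS]mx3P !mxE sum_ord3.
Qed.

(* A basis in which two axes of the form are isotropic, so that the restriction
   to a coordinate plane is degenerate. *)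
Lemma eqv_sl2_null : eqv (diag3 1 1 (-1)) (mx3 0 0 1 0 1 0 1 0 0 : 'M[R]_3).
Proof.
apply: (@eqv_mx3 _ 1 0 2^-1 0 (-1) 0 1 0 (- 2^-1) 1);
  [exact: oner_neq0 | by field |].
rewrite /diag3 tr_mx3 !mul_mx3 scale_mx3; congr mx3; by field.
Qed.

(** The exponents (0, 1, 1) keep exactly the lower right 2x2 block, which has rank one in the
    isotropic basis. *)
Lemma weight_contracts_sl2_h3 :
  weight_contracts 1 (diag3 1 1 (-1)) (diag3 1 0 0).
Proof.
exists (exps 0 1 1), (mx3 0 0 1 0 1 0 1 0 0); split.
- by elim/ord3P; rewrite expsE.
- exact: eqv_sl2_null.
- by elim/ord3P; elim/ord3P; rewrite mx3E sum_ord3 !expsE ?eqxx.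
suff -> : weight_limit (exps 0 1 1) (mx3 0 0 1 0 1 0 1 0 0) = diag3 0 1 0.
  exact: eqv_swap01.
by apply/matrixP; elim/ord3P; elim/ord3P; rewrite mxE sum_ord3 !expsE !mx3E.
Qed.

Lemma degen_diag_eq0 N N0 i : degen N N0 -> N^T = - N -> N0 i i = 0.
Proof.
move=> dN; rewrite -scaleN1r => /(degen_sym dN)/matrixP/(_ i i).
rewrite !mxE mulN1r => /eqP; rewrite -addr_eq0 -mulr2n -mulr_natl mulf_eq0.
by rewrite pnatr_eq0 => /eqP.
Qed.

(** The Killing form of sl(2,R) is Lorentzian and satisfies the reverse Cauchy-Schwarz inequality at
    its negative vectors; the negative definite form of so(3) violates it on two orthogonal
    vectors. *)
Lemma degen_sl2_so3 : ~ degen (diag3 1 1 (-1) : 'M[R]_3) (diag3 1 1 1).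
Proof.
move=> /degen_reverse_CS rCS.
suff : killing (diag3 1 1 1) (vec3 1 0 0) (vec3 1 0 0) *
    killing (diag3 1 1 1) (vec3 0 1 0) (vec3 0 1 0) <=
    killing (diag3 1 1 1) (vec3 1 0 0) (vec3 0 1 0) ^+ 2.
  by rewrite !killing_diag3 !vec3E; lra.
apply: rCS => [x y|]; last by rewrite killing_diag3 !vec3E; lra.
rewrite !killing_diag3.
move: (x i0 0) (x i1 0) (x i2 0) (y i0 0) (y i1 0) (y i2 0).
move=> x0 x1 x2 y0 y1 y2 ltx.
(* w = x × y is orthogonal to x, so x2 w2 = - (x0 w0 + x1 w1), and the claim
   reduces to Cauchy-Schwarz in the plane. *)
pose w0 := x1 * y2 - x2 * y1; pose w1 := x2 * y0 - x0 * y2.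
pose w2 := x0 * y1 - x1 * y0.
have lexx : x0 ^+ 2 + x1 ^+ 2 < x2 ^+ 2 by nra.
suff : w2 ^+ 2 <= w0 ^+ 2 + w1 ^+ 2 by rewrite /w0 /w1 /w2; nra.
have x2_gt0 : 0 < x2 ^+ 2 by nra.
rewrite -(ler_pM2l x2_gt0).
have -> : x2 ^+ 2 * w2 ^+ 2 = (x0 * w0 + x1 * w1) ^+ 2.
  by rewrite /w0 /w1 /w2; ring.
apply: (@le_trans _ _ ((x0 ^+ 2 + x1 ^+ 2) * (w0 ^+ 2 + w1 ^+ 2))).
  rewrite -subr_ge0.
  have -> : (x0 ^+ 2 + x1 ^+ 2) * (w0 ^+ 2 + w1 ^+ 2) -
      (x0 * w0 + x1 * w1) ^+ 2 = (x0 * w1 - x1 * w0) ^+ 2 by ring.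
  exact: sqr_ge0.
by apply: ler_wpM2r (ltW lexx); apply: addr_ge0; apply: sqr_ge0.
Qed.

End Table.

(** * The degeneration table *)

Section Obstructions.
Variable R : realType.
Implicit Types (M N : 'M[R]_3) (x y : 'cV[R]_3) (a b c d h p q r t : R).

(** The structure matrix is antisymmetric for every [t]; t = 0 is the abelian algebra and t = 1 the
    other normal form without symmetric part. *)
Lemma degen_abelian M t i : degen (lie3 0 0 0 t 0 0) M -> M i i = 0.
Proof.
move=> dM; apply: degen_diag_eq0 dM _.
by rewrite -[RHS]scaleN1r /lie3 tr_mx3 scale_mx3 !mulN1r ?opprK !oppr0.
Qed.

Lemma degen_abelian_diag3 t b c : ~ degen (lie3 0 0 0 t 0 0) (diag3 1 b c).
Proof.
by move=> /(degen_abelian i0)/eqP; rewrite /diag3 mx3E oner_eq0.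
Qed.

Lemma degen_abelian_lie3 t h :
  ~ degen (lie3 0 0 0 t 0 0) (lie3 0 1 h 1 0 0).
Proof.
by move=> /(degen_abelian i1)/eqP; rewrite /lie3 mx3E oner_eq0.
Qed.

Lemma degen_unimodular a b c b' c' :
  ~ degen (diag3 a b c) (lie3 0 b' c' 1 0 0).
Proof.
have sy : (diag3 a b c)^T = 1 *: diag3 a b c by rewrite scale1r /diag3 tr_mx3.
move=> /degen_sym/(_ sy)/matrixP/(_ i1 i2).
rewrite scale1r mxE /lie3 !mx3E => /eqP.
by rewrite -addr_eq0 -mulr2n pnatr_eq0.
Qed.

Lemma degen_singular M a b c : \det M = 0 -> a * b * c != 0 ->
  ~ degen M (diag3 a b c).
Proof.
move=> detM0 abc0 /degen_det0/(_ detM0)/eqP; apply/negP; rewrite /diag3 det_mx3.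
by rewrite !(mulr0, mul0r, subr0, addr0) mulrA.
Qed.

Lemma degen_h3 a b c : degen (diag3 1 0 0) (diag3 a b c) -> a * b = 0.
Proof.
move=> /degen_killing_trad dk.
have k0 x : killing (diag3 1 0 0) x x = 0 * \tr (ad (diag3 1 0 0) x) ^+ 2 :> R.
  by rewrite killing_diag3; ring.
by move: (dk _ k0 (vec3 0 0 1)); rewrite killing_diag3 !vec3E; lra.
Qed.

(** Here K(x, x) = (1 - h)/2 (tr ad x)^2. In the unimodular target the trace vanishes, so its
    Killing form would vanish too. *)
Lemma degen_nonunimodular_diag3 a b c h :
  degen (lie3 0 1 h 1 0 0) (diag3 a b c) -> a * b = 0.
Proof.
move=> /degen_killing_trad dk.
have kh x : killing (lie3 0 1 h 1 0 0) x x =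
    (1 - h) / 2 * \tr (ad (lie3 0 1 h 1 0 0) x) ^+ 2.
  by rewrite killing_lie3 trad_lie3; field.
move: (dk _ kh (vec3 0 0 1)).
by rewrite killing_diag3 trad_diag3 !vec3E; lra.
Qed.

(** The ratio of the Killing form to the squared trace recovers the parameter. *)
Lemma degen_nonunimodular b c h :
  degen (lie3 0 1 h 1 0 0) (lie3 0 b c 1 0 0) -> b * c = h.
Proof.
move=> /degen_killing_trad dk.
have kh x : killing (lie3 0 1 h 1 0 0) x x =
    (1 - h) / 2 * \tr (ad (lie3 0 1 h 1 0 0) x) ^+ 2.
  by rewrite killing_lie3 trad_lie3; field.
move: (dk _ kh (vec3 1 0 0)).
by rewrite killing_lie3 trad_lie3 !vec3E; lra.
Qed.

Lemma degen_diag3_ge0 a b c p q r : degen (diag3 p q r) (diag3 a b c) ->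
  0 <= q * r -> 0 <= p * r -> 0 <= p * q -> 0 <= b * c /\ 0 <= a * b.
Proof.
move=> dN qr pr pq; have k_le0 x : killing (diag3 p q r) x x <= 0.
  rewrite killing_diag3 mulNr oppr_le0 mulr_ge0 // -!expr2.
  by rewrite !addr_ge0 // mulr_ge0 // sqr_ge0.
have k := degen_killing_le0 dN k_le0.
have := k (vec3 1 0 0); have := k (vec3 0 0 1).
by rewrite !killing_diag3 !vec3E; split; lra.
Qed.

Lemma degen_diag3_le0 a b c p q r : degen (diag3 p q r) (diag3 a b c) ->
  q * r <= 0 -> p * r <= 0 -> p * q <= 0 -> a * b <= 0.
Proof.
move=> dN qr pr pq; have k_ge0 x : 0 <= killing (diag3 p q r) x x.
  rewrite killing_diag3 mulNr oppr_ge0 pmulr_rle0 // -!expr2.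
  by rewrite -oppr_ge0 !opprD !addr_ge0 // -mulNr mulr_ge0 ?sqr_ge0 ?oppr_ge0.
have := degen_killing_ge0 dN k_ge0 (vec3 0 0 1).
by rewrite !killing_diag3 !vec3E; lra.
Qed.

(** The outer cases run over the target, the inner ones over the source, both in the order of
    [normal_form]. Each pair gets explicit exponents or an obstruction, except so(3) to h3. *)
Lemma normal_form_degen N N0 : normal_form N -> normal_form N0 -> degen N N0 ->
  weight_contracts 1 N N0 \/ N = diag3 1 1 1 /\ N0 = diag3 1 0 0.
Proof.
have det_diag3 p q : \det (diag3 p q 0) = 0 by rewrite /diag3 det_mx3; ring.
have det_lie3 b c t : \det (lie3 0 b c t 0 0) = 0.
  by rewrite /lie3 det_mx3; ring.
have nz11 : 1 * 1 != 0 :> R by rewrite mul1r oner_neq0.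
have nz11' : 1 * -1 != 0 :> R by rewrite mul1r oppr_eq0 oner_neq0.
have nz111 : 1 * 1 * 1 != 0 :> R by rewrite !mul1r oner_neq0.
have nz111' : 1 * 1 * -1 != 0 :> R by rewrite !mul1r oppr_eq0 oner_neq0.
have ge01 : 0 <= 1 * 1 :> R by rewrite mulr1 ler01.
have ge00 t : 0 <= t * 0 :> R by rewrite mulr0.
have le00 t : t * 0 <= 0 :> R by rewrite mulr0.
move=> + nfN0; case: nfN0 => [||||||| h0] nfN.
- by move=> _; left; apply: weight_contracts0.
- case: nfN => [||||||| h].
  + by rewrite [diag3 0 0 0]diag3E => /degen_abelian_diag3.
  + by move=> _; left; apply: weight_contracts_id.
  + move=> _; left; rewrite [diag3 1 1 0]diag3E.
    apply: (weight_contracts_lie3 (p := 0) (q := 1) (r := 1) _ _ _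
      (eqv_refl _)); rewrite ?eqxx ?orbT //=.
    by rewrite -diag3E; apply: eqv_swap01.
  + move=> _; left; rewrite [diag3 1 (-1) 0]diag3E.
    apply: (weight_contracts_lie3 (p := 0) (q := 1) (r := 1) _ _ _
      (eqv_refl _)); rewrite ?eqxx ?orbT //=.
    rewrite -diag3E; apply: eqv_trans (eqv_swap01 _ _ _) _.
    apply: eqv_trans (eqv_opp _) _.
    by rewrite opp_diag3 opprK oppr0; apply: eqv_refl.
  + by right.
  + by move=> _; left; apply: weight_contracts_sl2_h3.
  + by move=> /degen_abelian_diag3.
  + move=> _; left.
    apply: (weight_contracts_lie3 (p := 1) (q := 1) (r := 0) _ _ _
      (eqv_refl _)); rewrite ?eqxx ?orbT //=.
    by rewrite -diag3E; apply: eqv_swap01.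
- case: nfN => [||||||| h].
  + by rewrite [diag3 0 0 0]diag3E => /degen_abelian_diag3.
  + by move=> /degen_h3 /eqP; rewrite (negPf nz11).
  + by move=> _; left; apply: weight_contracts_id.
  + move=> /degen_diag3_le0 dN; exfalso; suff : (1 : R) * 1 <= 0 by lra.
    by apply: dN; lra.
  + move=> _; left; rewrite [diag3 1 1 1]diag3E.
    apply: (weight_contracts_lie3 (p := 1) (q := 1) (r := 0) _ _ _
      (eqv_refl _)); rewrite ?eqxx ?orbT //=.
    by rewrite -diag3E; apply: eqv_refl.
  + move=> _; left; rewrite [diag3 1 1 (-1)]diag3E.
    apply: (weight_contracts_lie3 (p := 1) (q := 1) (r := 0) _ _ _
      (eqv_refl _)); rewrite ?eqxx ?orbT //=.
    by rewrite -diag3E; apply: eqv_refl.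
  + by move=> /degen_abelian_diag3.
  + by move=> /degen_nonunimodular_diag3 /eqP; rewrite (negPf nz11).
- case: nfN => [||||||| h].
  + by rewrite [diag3 0 0 0]diag3E => /degen_abelian_diag3.
  + by move=> /degen_h3 /eqP; rewrite (negPf nz11').
  + by move=> /degen_diag3_ge0 dN; exfalso; have [] := dN; lra.
  + by move=> _; left; apply: weight_contracts_id.
  + by move=> /degen_diag3_ge0 dN; exfalso; have [] := dN; lra.
  + move=> _; left; rewrite [diag3 1 1 (-1)]diag3E.
    apply: (weight_contracts_lie3 (p := 0) (q := 1) (r := 1) _ _ _
      (eqv_refl _)); rewrite ?eqxx ?orbT //=.
    by rewrite diag3E; apply: eqv_rot.
  + by move=> /degen_abelian_diag3.
  + by move=> /degen_nonunimodular_diag3 /eqP; rewrite (negPf nz11').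
- case: nfN => [||||||| h]; try by move=> /degen_singular; case.
  + by move=> _; left; apply: weight_contracts_id.
  + by move=> /degen_sl2_so3.
- case: nfN => [||||||| h]; try by move=> /degen_singular; case.
  + by move=> /degen_diag3_ge0 dN; exfalso; have [] := dN; lra.
  + by move=> _; left; apply: weight_contracts_id.
- case: nfN => [||||||| h]; try by move=> /degen_unimodular.
  + by move=> _; left; apply: weight_contracts_id.
  (* The invariant forces h = 0, so the one diagonal position with a negative exponent is empty. *)
  + move=> /degen_nonunimodular; rewrite mulr0 => <-; left.
    apply: (weight_contracts_lie3 (p := 0) (q := 0) (r := 1) _ _ _
      (eqv_refl _)); rewrite ?eqxx ?orbT //=.
    exact: eqv_refl.
- case: nfN => [||||||| h]; try by move=> /degen_unimodular.
  + by move=> /degen_abelian_lie3.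
  + move=> /degen_nonunimodular; rewrite mul1r => ->; left.
    exact: weight_contracts_id.
Qed.

(** The diagonal exponents are 4 - 2α_i = 0, 2, 2, so only the first diagonal entry survives. *)
Lemma weight_contracts_so3_h3 :
  weight_contracts 2 (diag3 1 1 1) (diag3 1 0 0 : 'M[R]_3).
Proof.
rewrite [diag3 1 1 1]diag3E.
apply: (weight_contracts_lie3 (p := 2) (q := 1) (r := 1) _ _ _
  (eqv_refl _)); rewrite ?eqxx ?orbT //=.
by rewrite -diag3E; apply: eqv_refl.
Qed.

End Obstructions.

(** * Weights and diagonal contractions *)

Section DiagonalContractions.
Local Open Scope classical_set_scope.
Variable R : realType.
Implicit Types (M N P Q : 'M[R]_3) (x y : 'cV[R]_3) (alpha : 'I_3 -> nat).

Definition diag_pow alpha (e : R) : 'M[R]_3 := diag_mx (\row_i (e ^+ alpha i)).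

Lemma det_diag_pow alpha e : \det (diag_pow alpha e) = e ^+ \sum_k alpha k.
Proof.
by rewrite det_diag expr_sum; apply: eq_bigr => i _; rewrite mxE.
Qed.

Lemma diag_pow_conj alpha e M i j :
  (diag_pow alpha e *m M *m (diag_pow alpha e)^T) i j =
  e ^+ (alpha i + alpha j) * M i j.
Proof.
by rewrite tr_diag_mx mul_mx_diag mxE mul_diag_mx !mxE exprD; ring.
Qed.

(** A boolean limit treats the surviving and the vanishing entries uniformly. *)
Lemma expr_cvg0 n : e ^+ n @[e --> (0 : R)^'+] --> ((n == 0)%N%:R : R).
Proof.
rewrite -expr0n; apply: cvg_at_right_filter; exact: exprn_continuous.
Qed.

Lemma diag_contraction_continuous P Q alpha :
  {within `]0, 1], continuous (diag_contraction_matrix P Q alpha)}.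
Proof.
apply: continuous_subspaceT => e.
apply: cvg_mulmx; last exact: cvg_cst.
apply: cvg_mulmx; first exact: cvg_cst.
apply/cvg_mxP => i j; rewrite !mxE; under eq_fun do rewrite !mxE.
case: (i == j); last exact: cvg_cst.
by rewrite mulr1n; under eq_fun do rewrite mulr1n; exact: exprn_continuous.
Qed.

Lemma diag_contraction_unit P Q alpha e : P \in unitmx -> Q \in unitmx ->
  0 < e <= 1 -> diag_contraction_matrix P Q alpha e \in unitmx.
Proof.
move=> Pu Qu /andP[e0 _]; rewrite /diag_contraction_matrix !unitmx_mul.
rewrite Pu Qu andbT unitmxE -/(diag_pow alpha e) det_diag_pow unitfE.
by rewrite expf_neq0 // gt_eqF.
Qed.

Lemma weight_contracts_diag k M M0 : weight_contracts k M M0 ->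
  exists P Q alpha, [/\ P \in unitmx, Q \in unitmx,
    forall i, (alpha i <= k)%N & diag_contracts (brM M) (brM M0) P Q alpha].
Proof.
move=> [alpha [N [alphak [P Pu eqP] bN eqN]]].
exists P, 1%:M, alpha; split=> //; first exact: unitmx1.
exists (brM (weight_limit alpha N)); split; last exact/eqv_lie_iso/eqv_sym.
(* [K e] is the structure matrix in the basis [U e]. The truncated subtraction is harmless: where it
   truncates a negative exponent, [N i j] is zero. *)
pose K e : 'M[R]_3 :=
  \matrix_(i, j) (N i j * e ^+ (\sum_k alpha k - (alpha i + alpha j))).
pose U := diag_contraction_matrix P 1%:M alpha.
have Uu e : 0 < e <= 1 -> U e \in unitmx.
  by apply: diag_contraction_unit => //; exact: unitmx1.
have eqK e : 0 < e <= 1 -> U e *m K e *m (U e)^T = \det (U e) *: M.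
  move=> e01; rewrite /U /diag_contraction_matrix mulmx1 -/(diag_pow alpha e).
  have KN : diag_pow alpha e *m K e *m (diag_pow alpha e)^T =
      e ^+ (\sum_k alpha k) *: N.
    apply/matrixP => i j; rewrite diag_pow_conj !mxE mulrCA -exprD mulrC.
    have [->|/bN le] := eqVneq (N i j) 0; first by rewrite !mulr0.
    by rewrite subnKC.
  rewrite trmx_mul !mulmxA -[_ *m K e]mulmxA -[P *m _ *m _]mulmxA KN.
  by rewrite -scalemxAr -scalemxAl eqP scalerA det_mulmx det_diag_pow mulrC.
split; [exact: Uu | exact: diag_contraction_continuous | move=> x y].
have cK : K e *m so3 x y @[e --> 0^'+] --> brM (weight_limit alpha N) x y.
  apply: cvg_mulmx; last exact: cvg_cst.
  apply/cvg_mxP => i j; under eq_fun do rewrite mxE.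
  have -> : weight_limit alpha N i j =
      N i j * (\sum_k alpha k - (alpha i + alpha j) == 0)%N%:R.
    rewrite mxE subn_eq0; have [N0|/bN le] := eqVneq (N i j) 0.
      by rewrite N0 mul0r if_same.
    by rewrite eqn_leq le /=; case: ifP; rewrite ?mulr1 ?mulr0.
  by apply: cvgM; [exact: cvg_cst | exact: expr_cvg0].
apply: cvg_trans cK; apply: near_eq_cvg; near=> e.
rewrite -/U (conj_brM (Uu e _) (eqK e _)) //; near: e; exact: near_right01.
Unshelve. all: by end_near.
Qed.

Lemma diag_contracts_weight M M0 P Q alpha : P \in unitmx -> Q \in unitmx ->
  diag_contracts (brM M) (brM M0) P Q alpha ->
  exists N, [/\ eqv M N, weights_bounded alpha N &
    eqv (weight_limit alpha N) M0].
Proof.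
move=> Pu Qu [br1 [ctr [A [Au eqA]]]].
have Qt : Q^T \in unitmx by rewrite unitmx_tr.
have Pt : P^T \in unitmx by rewrite unitmx_tr.
have dQ : \det Q != 0 by rewrite -unitfE -unitmxE.
pose M1 := act_mx A M0; pose N := act_mx P M.
have br1E : br1 = brM M1.
  rewrite -(conj_brM Au (act_mxE M0 Au)); apply/funext => x; apply/funext => y.
  by rewrite /conj_bracket -eqA mulKmx.
rewrite br1E in ctr; have cF := contraction_act_mx ctr.
set U := diag_contraction_matrix P Q alpha in ctr cF.
(* [twist] undoes the constant factor [Q], so that the twisted curve is [N] acted on by the diagonal
   powers alone. *)
pose twist K := (\det Q)^-1 *: (Q *m K *m Q^T).
have cG i j : twist (act_mx (U e) M) i j @[e --> 0^'+] --> twist M1 i j.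
  move: i j; apply/cvg_mxP; rewrite /twist.
  under eq_fun do rewrite scalemxAl scalemxAl.
  rewrite !scalemxAl.
  apply: cvg_mulmx; last exact: cvg_cst.
  by apply: cvg_mulmx; [exact: cvg_cst | exact: cF].
(* Both powers are kept on opposite sides, which avoids negative exponents in the naturals. *)
have eqG e i j : 0 < e <= 1 ->
    e ^+ (alpha i + alpha j) * twist (act_mx (U e) M) i j =
    e ^+ (\sum_k alpha k) * N i j.
  move=> e01; have Ue : U e \in unitmx by apply: diag_contraction_unit.
  have := act_mxE M Ue; set F := act_mx _ _.
  have UE : U e = P *m diag_pow alpha e *m Q by [].
  rewrite {1 2 3}UE !det_mulmx det_diag_pow => eqF.
  suff : diag_pow alpha e *m twist F *m (diag_pow alpha e)^T =
      e ^+ (\sum_k alpha k) *: N.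
    by move/matrixP => /(_ i j); rewrite diag_pow_conj => ->; rewrite mxE.
  apply: (can_inj (mulKmx Pu)); apply: (can_inj (mulmxK Pt)).
  rewrite -[in RHS]scalemxAr -[in RHS]scalemxAl act_mxE // scalerA.
  apply: (scalerI dQ); rewrite scalerA.
  have -> : \det Q * (e ^+ (\sum_k alpha k) * \det P) =
    \det P * e ^+ (\sum_k alpha k) * \det Q by ring.
  rewrite -eqF scalemxAl scalemxAr scalemxAl scalemxAr scalerA divff // scale1r.
  by rewrite !trmx_mul !mulmxA.
have lim_eq (f g : R -> R) (a b : R) : f e @[e --> 0^'+] --> a ->
    g e @[e --> 0^'+] --> b -> (forall e, 0 < e <= 1 -> f e = g e) -> a = b.
  move=> cf cg fg; apply/eqP; rewrite eq_le; apply/andP.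
  by split; [apply: (ler_cvg_to cf cg) | apply: (ler_cvg_to cg cf)];
    near=> e; rewrite fg //; near: e; exact: near_right01.
have e_neq0 (e : R) n : 0 < e <= 1 -> e ^+ n != 0.
  by case/andP=> e0 _; rewrite expf_neq0 // gt_eqF.
have bN : weights_bounded alpha N.
  (* If the exponent were negative, the constant [N i j] would equal a positive power of e times a
     convergent function, hence be zero. *)
  move=> i j; apply: contraNT; rewrite -ltnNge => lt_ij.
  have : e ^+ (alpha i + alpha j - \sum_k alpha k) *
      twist (act_mx (U e) M) i j @[e --> 0^'+] -->
      (alpha i + alpha j - \sum_k alpha k == 0)%N%:R * twist M1 i j.
    by apply: cvgM; [exact: expr_cvg0 | exact: cG].
  rewrite subn_eq0 leqNgt lt_ij mul0r => c0; apply/eqP.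
  apply: lim_eq (cvg_cst (N i j)) c0 _ => e e01.
  apply: (mulfI (e_neq0 e (\sum_k alpha k)%N e01)).
  by rewrite -eqG // mulrA -exprD subnKC // ltnW.
have M2E : weight_limit alpha N = twist M1.
  apply/matrixP => i j; rewrite mxE; have [N0|/bN le_ij] := eqVneq (N i j) 0.
    rewrite N0 if_same; apply: lim_eq (cvg_cst 0) (cG i j) _ => e e01.
    apply: (mulfI (e_neq0 e (alpha i + alpha j)%N e01)).
    by rewrite eqG // N0 !mulr0.
  have : e ^+ (\sum_k alpha k - (alpha i + alpha j)) * N i j @[e --> 0^'+] -->
      (\sum_k alpha k - (alpha i + alpha j) == 0)%N%:R * N i j.
    by apply: cvgM; [exact: expr_cvg0 | exact: cvg_cst].
  rewrite subn_eq0 => cN.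
  have <- : (\sum_k alpha k <= alpha i + alpha j)%N%:R * N i j = twist M1 i j.
    apply: lim_eq cN (cG i j) _ => e e01.
    apply: (mulfI (e_neq0 e (alpha i + alpha j)%N e01)).
    by rewrite eqG // mulrA -exprD subnKC.
  by rewrite eqn_leq le_ij /=; case: ifP; rewrite ?mul1r ?mul0r.
exists N; split=> //; first exact: eqv_act_mx.
rewrite M2E; apply: (@eqv_trans _ M1); last exact/eqv_sym/eqv_act_mx.
by exists Q => //; rewrite /twist scalerA divff // scale1r.
Unshelve. all: by end_near.
Qed.

End DiagonalContractions.

(** * From so(3) to the Heisenberg algebra *)

Section So3ToHeisenberg.
Variable R : realType.
Implicit Types (M N : 'M[R]_3).

(** [N] is a nonzero multiple of V V^T, so v N v^T is a multiple of the squared length of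
    [v *m V]. *)
Lemma eqv_so3_anisotropic N (v : 'rV[R]_3) :
  eqv 1%:M N -> (v *m N *m v^T) 0 0 = 0 -> v = 0.
Proof.
move=> /eqv_sym [V Vu]; rewrite mulmx1 => eqV.
have dV : \det V != 0 by rewrite -unitfE -unitmxE.
move=> qv0; have : (\det V *: (v *m N *m v^T)) 0 0 = 0 by rewrite mxE qv0 mulr0.
rewrite scalemxAl scalemxAr -eqV.
have -> : v *m (V *m V^T) *m v^T = (v *m V) *m (v *m V)^T.
  by rewrite trmx_mul !mulmxA.
rewrite mxE => /eqP.
rewrite psumr_eq0 => [/allP w0|k _]; last first.
  by rewrite [X in _ * X]mxE -expr2 sqr_ge0.
suff vV0 : v *m V = 0 by rewrite -[v](mulmxK Vu) vV0 mul0mx.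
apply/rowP => k; have := w0 k (mem_index_enum k).
by rewrite [X in _ * X]mxE mulf_eq0 orbb => /eqP ->; rewrite mxE.
Qed.

Lemma eqv_so3_diag N j : eqv 1%:M N -> N j j != 0.
Proof.
move=> eqN; apply/eqP => Njj.
have /rowP/(_ j) : delta_mx (0 : 'I_1) j = 0 :> 'rV[R]_3.
  by apply: eqv_so3_anisotropic eqN _; rewrite delta_mx_form.
by rewrite !mxE !eqxx => /eqP; rewrite oner_eq0.
Qed.

Lemma eqv_so3_minor N i j : eqv 1%:M N -> i != j ->
  N i i * N j j != N i j * N j i.
Proof.
move=> eqN neq_ij.
have Njj := eqv_so3_diag j eqN; apply/eqP => minor0.
(* The form takes the value N_jj times the minor at this vector, whose i-th coordinate is N_jj. *)
pose v : 'rV[R]_3 := N j j *: delta_mx 0 i - N i j *: delta_mx 0 j.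
have /rowP/(_ i) : v = 0; last first.
  by rewrite !mxE !eqxx (negPf neq_ij) /= mulr0 subr0 mulr1; apply/eqP.
apply: eqv_so3_anisotropic eqN _.
have addE (A B : 'M[R]_1) : (A + B) 0 0 = A 0 0 + B 0 0 by rewrite mxE.
have oppE (A : 'M[R]_1) : (- A) 0 0 = - A 0 0 by rewrite mxE.
have scaleE t (A : 'M[R]_1) : (t *: A) 0 0 = t * A 0 0 by rewrite mxE.
have -> : v^T = N j j *: (delta_mx 0 i)^T - N i j *: (delta_mx 0 j)^T.
  by apply/colP => k; rewrite !mxE.
rewrite /v !(mulmxBl, mulmxBr) -!(scalemxAl, scalemxAr).
rewrite !(addE, oppE, scaleE, delta_mx_form).
transitivity (N j j * (N i i * N j j - N i j * N j i)); first by ring.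
by rewrite minor0 subrr mulr0.
Qed.

Lemma eqv_h3_minor N i j : eqv (diag3 1 0 0) N -> N i i * N j j = N i j * N j i.
Proof.
move=> /eqv_sym [V Vu eqV]; have dV : \det V != 0 by rewrite -unitfE -unitmxE.
(* Up to a scalar, [N] is the outer product of the first column of [V] with itself, so it has rank
   one. *)
have NE k l : \det V * N k l = V k i0 * V l i0.
  have /matrixP/(_ k l) := eqV; rewrite [RHS]mxE => <-.
  rewrite mxE sum_ord3 !mxE !sum_ord3 /diag3 !mx3E; ring.
apply: (mulfI dV); apply: (mulfI dV).
transitivity ((\det V * N i i) * (\det V * N j j)); first by ring.
transitivity ((\det V * N i j) * (\det V * N j i)); last by ring.
rewrite !NE; ring.
Qed.

(** Let s be the sum of the exponents. Nonzero diagonal entries force 2α_i <= s, which rules out s =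
    1. For s = 0 or 2 two equal exponents s/2 keep a nonzero 2x2 minor, and for s = 3 the limit is
    zero. *)
Lemma weight_limit_so3_h3 alpha N : eqv 1%:M N ->
  (forall i, (alpha i <= 1)%N) -> weights_bounded alpha N ->
  ~ eqv (diag3 1 0 0) (weight_limit alpha N).
Proof.
move=> eqN alpha1 bN eqL.
have no_pair i j : i != j -> alpha i = alpha j ->
    (alpha i + alpha i)%N = (\sum_k alpha k)%N -> False.
  move=> neq_ij aij ai; have := eqv_h3_minor i j eqL.
  by rewrite !mxE -aij ai eqxx; apply/eqP/eqv_so3_minor.
have sumE : (\sum_k alpha k = alpha i0 + alpha i1 + alpha i2)%N.
  by rewrite sum_ord3.
have [i [j lim_ij]] : exists i j, (alpha i + alpha j)%N = (\sum_k alpha k)%N.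
  apply: contrapT => no_lim; move: eqL => [V].
  have -> : weight_limit alpha N = 0.
    apply/matrixP => i j; rewrite !mxE; case: eqP => // lim_ij.
    by case: no_lim; exists i, j.
  rewrite unitmxE unitfE mulmx0 mul0mx => /eqP dV /matrixP/(_ i0 i0).
  by rewrite [LHS]mxE [RHS]mxE /diag3 mx3E mulr1 => /esym.
have := bN _ _ (eqv_so3_diag i0 eqN); have := bN _ _ (eqv_so3_diag i1 eqN).
have := bN _ _ (eqv_so3_diag i2 eqN).
have := no_pair i0 i1; have := no_pair i0 i2; have := no_pair i1 i2.
rewrite -!val_eqE /= !inord3K sumE in lim_ij *.
have := alpha1 i; have := alpha1 j.
have := alpha1 i0; have := alpha1 i1; have := alpha1 i2; lia.
Qed.

End So3ToHeisenberg.

(** * Invariance under isomorphism and assembly of the theorem *)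

Section Transport.
Variable R : realType.
Implicit Types (M N : 'M[R]_3).

Lemma weight_contracts_eqv k M M0 N N0 : eqv M N -> weight_contracts k N N0 ->
  eqv N0 M0 -> weight_contracts k M M0.
Proof.
move=> eqMN [alpha [K [alphak eqNK bK eqK]]] eqNM0; exists alpha, K; split=> //.
  exact: eqv_trans eqNK.
exact: eqv_trans eqNM0.
Qed.

End Transport.

Theorem theorem2 (R : realType) (g g0 : bracket R) :
  is_lie g -> is_lie g0 -> is_lie_contraction g g0 ->
  [/\ (exists (P Q : 'M[R]_3) (alpha : 'I_3 -> nat),
         [/\ P \in unitmx, Q \in unitmx & diag_contracts g g0 P Q alpha]),
      (~ (lie_iso g (@so3 R) /\ lie_iso g0 (@h3 R)) ->
         exists (P Q : 'M[R]_3) (alpha : 'I_3 -> nat),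
           [/\ P \in unitmx, Q \in unitmx, (forall i, (alpha i <= 1)%N)
             & diag_contracts g g0 P Q alpha]) &
      (lie_iso g (@so3 R) -> lie_iso g0 (@h3 R) ->
         ~ exists (P Q : 'M[R]_3) (alpha : 'I_3 -> nat),
           [/\ P \in unitmx, Q \in unitmx, (forall i, (alpha i <= 1)%N)
             & diag_contracts g g0 P Q alpha])].
Proof.
move=> lieg lieg0; have [M gM] := is_lie_brM lieg.
have [M0 g0M0] := is_lie_brM lieg0; subst g g0.
have [N eqMN nfN] := lie_has_nf lieg; have [N0 eqMN0 nfN0] := lie_has_nf lieg0.
move=> [U /contraction_degen dM].
have dN : degen N N0 := degen_eqvl (eqv_sym eqMN) (degen_eqvr dM eqMN0).
(* The dichotomy for normal forms, carried back to the given structure matrices. *)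
have simple : weight_contracts 1 M M0 \/ eqv 1%:M M /\ eqv (diag3 1 0 0) M0.
  case: (normal_form_degen nfN nfN0 dN) => [wc|[NE N0E]].
    by left; apply: weight_contracts_eqv eqMN wc (eqv_sym eqMN0).
  by right; rewrite -diag3_1 -NE -N0E; split; apply: eqv_sym.
split.
- have [k /weight_contracts_diag [P [Q [alpha [Pu Qu _ ctr]]]]] :
      exists k, weight_contracts k M M0.
    case: simple => [wc|[eqM eqM0]]; first by exists 1%N.
    exists 2%N; apply: weight_contracts_eqv (weight_contracts_so3_h3 R) eqM0.
    by rewrite diag3_1; apply: eqv_sym.
  by exists P, Q, alpha.
- move=> not_exc; apply: weight_contracts_diag; case: simple => // -[eqM eqM0].
  by case: not_exc; rewrite so3_brM h3_brM; split; apply/eqv_lie_iso.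
rewrite so3_brM h3_brM => /eqv_lie_iso eqM /eqv_lie_iso eqM0.
move=> [P [Q [alpha [Pu Qu alpha1 /(diag_contracts_weight Pu Qu)]]]].
move=> [K [eqMK bK eqL]]; apply: (weight_limit_so3_h3 _ alpha1 bK).
  exact: eqv_trans eqM eqMK.
exact: eqv_trans eqM0 (eqv_sym eqL).
Qed.
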